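(* Let $X=X^\top\in\mathbb{R}^{n\times n}$ be a solution of CGCARE($\Sigma$). In a suitable basis of the state space $\mathbb{R}^n$, let the pair $(A_X,BG)$ be written in the reachability form $$\begin{bmatrix}A_{X,11}&A_{X,12}\\0&A_{X,22}\end{bmatrix},\qquad\begin{bmatrix}B_{2,1}\\0\end{bmatrix},$$ where the pair $(A_{X,11},B_{2,1})$ is completely reachable, and let $\Gamma_X=A_{X,22}$. Then the set of invariant zeros of the Hamiltonian system satisfies $$\mathcal{Z}(\hat A,\hat B,\hat C,\hat D)=\sigma(\Gamma_X)\cup\sigma(-\Gamma_X).$$
   Context: Let $A\in\mathbb{R}^{n\times n}$, $B,S\in\mathbb{R}^{n\times m}$, $Q\in\mathbb{R}^{n\times n}$, $R\in\mathbb{R}^{m\times m}$, with the standing assumption $\Pi=\begin{bmatrix}Q&S\\S^\top&R\end{bmatrix}=\Pi^\top\ge 0$ ($R$ may be singular), and let $\Sigma=(A,B,\Pi)$. $M^\dagger$ denotes the Moore–Penrose pseudo-inverse and $\sigma(\cdot)$ the spectrum. GCARE($\Sigma$) is the equation $XA+A^\top X-(S+XB)R^\dagger(S^\top+B^\top X)+Q=0$. CGCARE($\Sigma$) is GCARE($\Sigma$) together with the condition $\ker R\subseteq\ker(S+XB)$. $G=I_m-R^\dagger R$ is the orthogonal projector onto $\ker R$. For $X=X^\top$: $S_X=S+XB$, $K_X=R^\dagger S_X^\top$, $A_X=A-BK_X$. The Hamiltonian system associated with $\Sigma$ is the quadruple $(\hat A,\hat B,\hat C,\hat D)$ with $$\hat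 A=\begin{bmatrix}A&0\\-Q&-A^\top\end{bmatrix},\quad\hat B=\begin{bmatrix}B\\-S\end{bmatrix},\quad\hat C=[\,S^\top\;\;B^\top\,],\quad\hat D=R.$$ The set $\mathcal{Z}(\hat A,\hat B,\hat C,\hat D)$ of invariant zeros is the set of $s\in\mathbb{C}$ such that the rank of the Rosenbrock matrix $\begin{bmatrix}\hat A-sI_{2n}&\hat B\\\hat C&\hat D\end{bmatrix}$ is strictly smaller than its normal rank (its maximal rank over $s\in\mathbb{C}$). ''Written in the reachability form'' means that $H^{-1}A_XH$ and $H^{-1}BG$ have the displayed block forms for some nonsingular real matrix $H$. *)

(* Defs.v *)
From mathcomp Require Import all_boot all_order all_algebra.
From mathcomp Require Import all_classical all_reals.
From mathcomp Require Import complex.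

Set Implicit Arguments.
Unset Strict Implicit.
Unset Printing Implicit Defensive.

Import Order.TTheory GRing.Theory Num.Theory.

Local Open Scope ring_scope.
Local Open Scope classical_set_scope.
Local Open Scope complex_scope.

Section MoorePenrose.
Variable R : realType.

(* With the full-rank factorization M = C L, where C = col_base M and
   L = row_base M, one has M^+ = L^T (L L^T)^-1 (C^T C)^-1 C^T; the lemmas
   below confirm that it is the unique solution of the Penrose equations. *)
Definition mpinv m n (M : 'M[R]_(m, n)) : 'M[R]_(n, m) :=
  (row_base M)^T *m invmx (row_base M *m (row_base M)^T)
  *m invmx ((col_base M)^T *m col_base M) *m (col_base M)^T.

Definition penrose m n (M : 'M[R]_(m, n)) (N : 'M[R]_(n, m)) : Prop :=
  [/\ M *m N *m M = M, N *m M *m N = N,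
      (M *m N)^T = M *m N & (N *m M)^T = N *m M].

Lemma gram_unitmx m n (U : 'M[R]_(m, n)) : row_free U -> U *m U^T \in unitmx.
Proof.
move=> fU; rewrite -row_free_unit; apply/row_freeP.
suff k0 : kermx (U *m U^T) = 0.
  have : row_free (U *m U^T) by rewrite -kermx_eq0 k0.
  by move/row_freeP.
apply/row_matrixP => i; rewrite row0.
set v := row i _.
have v0 : v *m (U *m U^T) = 0 by rewrite -row_mul mulmx_ker row0.
suff vU : v *m U = 0 by apply: (row_free_inj fU); rewrite /= vU mul0mx.
have : (v *m U) *m (v *m U)^T = 0 by rewrite trmx_mul mulmxA -(mulmxA v) v0 mul0mx.
move: (v *m U) => w /matrixP/(_ 0 0); rewrite !mxE => /eqP.
rewrite psumr_eq0 => [/allP w0|j _]; last by rewrite [X in _ * X]mxE -expr2 sqr_ge0.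
apply/matrixP => a j; rewrite (ord1 a) [RHS]mxE.
have := w0 j (mem_index_enum _).
by rewrite [X in _ * X]mxE -expr2 sqrf_eq0 => /eqP.
Qed.

Lemma mpinvP m n (M : 'M[R]_(m, n)) : penrose M (mpinv M).
Proof.
have uL : row_base M *m (row_base M)^T \in unitmx.
  by apply: gram_unitmx; exact: row_base_free.
have uC : (col_base M)^T *m col_base M \in unitmx.
  rewrite -{2}[col_base M]trmxK; apply: gram_unitmx.
  by rewrite /row_free mxrank_tr; have := col_base_full M; rewrite /row_full.
have eM := mulmx_base M.
rewrite /penrose /mpinv; move: eM uL uC.
move: (col_base M) (row_base M); move: (\rank M) => k C L <- uL uC.
set GL := L *m L^T in uL *; set GC := C^T *m C in uC *.
have sL : (invmx GL)^T = invmx GL by rewrite trmx_inv /GL trmx_mul trmxK.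
have sC : (invmx GC)^T = invmx GC by rewrite trmx_inv /GC trmx_mul trmxK.
have e1 : C *m L *m (L^T *m invmx GL *m invmx GC *m C^T) = C *m invmx GC *m C^T.
  by rewrite !mulmxA -(mulmxA C L) -/GL -(mulmxA C GL) mulmxV // mulmx1.
have e2 : L^T *m invmx GL *m invmx GC *m C^T *m (C *m L) = L^T *m invmx GL *m L.
  by rewrite !mulmxA -(mulmxA _ C^T C) -/GC -(mulmxA _ (invmx GC)) mulVmx // mulmx1.
rewrite e1 e2; split.
- by rewrite !mulmxA -(mulmxA _ C^T C) -/GC -(mulmxA C) mulVmx // mulmx1.
- by rewrite !mulmxA -(mulmxA _ L L^T) -/GL -(mulmxA L^T) mulVmx // mulmx1.
- by rewrite !trmx_mul trmxK sC mulmxA.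
- by rewrite !trmx_mul trmxK sL mulmxA.
Qed.

Lemma penrose_unique m n (M : 'M[R]_(m, n)) (N1 N2 : 'M[R]_(n, m)) :
  penrose M N1 -> penrose M N2 -> N1 = N2.
Proof.
move=> [a1 b1 c1 d1] [a2 b2 c2 d2].
have l : M *m N1 = M *m N2.
  rewrite -{1}a2 -[_ *m M *m N1]mulmxA -c1 -{1}c2 -trmx_mul.
  by rewrite mulmxA a1 c2.
have r : N1 *m M = N2 *m M.
  rewrite -{1}a2 !mulmxA -[N1 *m M *m _ *m M]mulmxA -d1 -{1}d2 -trmx_mul.
  by rewrite !mulmxA -[_ *m M *m N1 *m M]mulmxA -(mulmxA N2) (mulmxA M) a1 d2.
by rewrite -b1 -mulmxA l mulmxA r b2.
Qed.

End MoorePenrose.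

Section Riccati.
Variables (R : realType) (n m : nat).
Implicit Types (A Q X : 'M[R]_n) (B S : 'M[R]_(n, m)) (W : 'M[R]_m).

(* The weight on the input is called W, R being the field of real numbers. *)

Definition possemidef k (P : 'M[R]_k) : Prop :=
  P = P^T /\ forall v : 'cV[R]_k, 0 <= (v^T *m P *m v) 0 0.

Definition Popov Q S W : 'M[R]_(n + m) := block_mx Q S S^T W.

Definition GCARE A B Q S W X : Prop :=
  X *m A + A^T *m X - (S + X *m B) *m mpinv W *m (S^T + B^T *m X) + Q = 0.

Definition CGCARE A B Q S W X : Prop :=
  GCARE A B Q S W X /\
  (forall v : 'cV[R]_m, W *m v = 0 -> (S + X *m B) *m v = 0).

Definition kerproj W : 'M[R]_m := 1%:M - mpinv W *m W.

Definition S_of B S X : 'M[R]_(n, m) := S + X *m B.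

Definition K_of B S W X : 'M[R]_(m, n) := mpinv W *m (S_of B S X)^T.

Definition A_of A B S W X : 'M[R]_n := A - B *m K_of B S W X.

Definition ham_A A Q : 'M[R]_(n + n) := block_mx A 0 (- Q) (- A^T).

Definition ham_B B S : 'M[R]_(n + n, m) := col_mx B (- S).

Definition ham_C B S : 'M[R]_(m, n + n) := row_mx S^T B^T.

End Riccati.

Section Systems.
Variable R : realType.

Definition cmx p q (M : 'M[R]_(p, q)) : 'M[R[i]]_(p, q) :=
  map_mx (real_complex R) M.

Definition reachability_mx n m (A : 'M[R]_n) (B : 'M[R]_(n, m)) :
  'M[R]_(n, \sum_(k < n) m) := \mxrow_(k < n) (A ^+ k *m B).

Definition reachable n m (A : 'M[R]_n) (B : 'M[R]_(n, m)) : Prop :=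
  \rank (reachability_mx A B) = n.

Definition spectrum n (A : 'M[R]_n) : set R[i] :=
  [set s | eigenvalue (cmx A) s].

Definition rosenbrock n m p (A : 'M[R]_n) (B : 'M[R]_(n, m))
    (C : 'M[R]_(p, n)) (D : 'M[R]_(p, m)) (s : R[i]) : 'M[R[i]]_(n + p, n + m) :=
  block_mx (cmx A - s%:M) (cmx B) (cmx C) (cmx D).

(* The maximum over s : R[i] is taken as the largest k that is the rank of the
   Rosenbrock matrix at some s; every such k is at most the number of rows. *)
Definition normal_rank n m p (A : 'M[R]_n) (B : 'M[R]_(n, m))
    (C : 'M[R]_(p, n)) (D : 'M[R]_(p, m)) : nat :=
  \max_(k < (n + p).+1 | `[< exists s, \rank (rosenbrock A B C D s) = k >]) k.

Lemma rank_le_normal_rank n m p (A : 'M[R]_n) (B : 'M[R]_(n, m))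
    (C : 'M[R]_(p, n)) (D : 'M[R]_(p, m)) s :
  (\rank (rosenbrock A B C D s) <= normal_rank A B C D)%N.
Proof.
have lt_s : (\rank (rosenbrock A B C D s) < (n + p).+1)%N.
  by rewrite ltnS rank_leq_row.
by apply: (leq_bigmax_cond (Ordinal lt_s)); apply/asboolP; exists s.
Qed.

Lemma normal_rank_attained n m p (A : 'M[R]_n) (B : 'M[R]_(n, m))
    (C : 'M[R]_(p, n)) (D : 'M[R]_(p, m)) :
  exists s, \rank (rosenbrock A B C D s) = normal_rank A B C D.
Proof.
have lt_0 : (\rank (rosenbrock A B C D 0%R) < (n + p).+1)%N.
  by rewrite ltnS rank_leq_row.
have ex0 : `[< exists s, \rank (rosenbrock A B C D s) = Ordinal lt_0 >].
  by apply/asboolP; exists 0%R.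
rewrite /normal_rank (bigop.bigmax_eq_arg (Ordinal lt_0)) //.
by case: arg_maxnP => // k /asboolP.
Qed.

Definition invariant_zeros n m p (A : 'M[R]_n) (B : 'M[R]_(n, m))
    (C : 'M[R]_(p, n)) (D : 'M[R]_(p, m)) : set R[i] :=
  [set s | (\rank (rosenbrock A B C D s) < normal_rank A B C D)%N].

End Systems.

(* Main.v *)
(* Write lambda = X x + mu and u = - K_X x + v.  Since X solves CGCARE, unimodular
   row and column operations with constant coefficients turn the Rosenbrock
   matrix of the Hamiltonian system into
     [A_X - s    - B W^+ B^T    B G]
     [   0       - A_X^T - s     0 ]
     [   0        (B G)^T        W ].
   As W and G act on complementary subspaces, W contributes rank W.  In the
   reachability basis the Hautus test says that [A11 - s, B21] and the transpose
   of [- A11 - s, B21] have full rank r for every complex s, so both can be split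
   off.  What remains is block triangular with diagonal blocks Gamma - s and
   - Gamma^T - s, and hence loses rank exactly at the eigenvalues of Gamma and
   - Gamma. *)
Require Import Defs.
From mathcomp Require Import all_boot all_order all_algebra.
From mathcomp Require Import all_classical all_reals.
From mathcomp Require Import complex ring.

Set Implicit Arguments.
Unset Strict Implicit.
Unset Printing Implicit Defensive.

Import Order.TTheory GRing.Theory Num.Theory.

Local Open Scope ring_scope.
Local Open Scope classical_set_scope.
Local Open Scope complex_scope.

(** * Ranks of sums and stacks of matrices *)

Section RankReduction.
Variable F : fieldType.

Lemma mxrank_conj_unit p q (L : 'M[F]_p) (M : 'M[F]_(p, q)) (U : 'M[F]_q) :
  L \in unitmx -> U \in unitmx -> \rank (L *m M *m U) = \rank M.
Proof.
move=> uL uU; rewrite mxrankMfree ?row_free_unit //.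
by rewrite (eqmxMfull M (_ : row_full L)) ?row_full_unit.
Qed.

(** [E] and [E'] recover the two summands from the sum, so its row space is the sum of theirs; [U]
    fixes one row space and kills the other, so they meet only in 0. *)
Lemma mxrank_add_split p q (M1 M2 : 'M[F]_(p, q)) (E E' : 'M[F]_p) (U : 'M[F]_q) :
    E *m M1 = M1 -> E *m M2 = 0 -> E' *m M1 = 0 -> E' *m M2 = M2 ->
    M1 *m U = M1 -> M2 *m U = 0 ->
  \rank (M1 + M2)%R = (\rank M1 + \rank M2)%N.
Proof.
move=> e11 e12 e21 e22 u1 u2; rewrite -mxrank_disjoint_sum.
  apply/eqP; rewrite eqn_leq; apply/andP; split; apply: mxrankS.
    by apply: addmx_sub_adds; exact: submx_refl.
  rewrite addsmx_sub; apply/andP; split.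
    have {1}<- : E *m (M1 + M2) = M1 by rewrite mulmxDr e11 e12 addr0.
    exact: submxMl.
  have {1}<- : E' *m (M1 + M2) = M2 by rewrite mulmxDr e21 e22 add0r.
  exact: submxMl.
apply/eqP; rewrite -submx0; apply/rV_subP => v; rewrite sub_capmx => /andP[].
case/submxP => x vx /submxP[y vy].
by rewrite submx0 vx -u1 mulmxA -vx vy -mulmxA u2 mulmx0.
Qed.

Lemma submx_col_mxl p1 p2 p3 q (M : 'M[F]_(p1, q)) (U : 'M_(p2, q))
    (V : 'M_(p3, q)) : (M <= U)%MS -> (M <= col_mx U V)%MS.
Proof. by move=> MU; rewrite -addsmxE (submx_trans MU) ?addsmxSl. Qed.

Lemma submx_col_mxr p1 p2 p3 q (M : 'M[F]_(p1, q)) (U : 'M_(p2, q))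
    (V : 'M_(p3, q)) : (M <= V)%MS -> (M <= col_mx U V)%MS.
Proof. by move=> MV; rewrite -addsmxE (submx_trans MV) ?addsmxSr. Qed.

(** If [x *m U = y *m V], multiplying by [Y] gives [x = 0], so the row spaces are disjoint; [Y] also
    shows that [U] has full row rank. *)
Lemma mxrank_col_mx_split p1 p2 q (U : 'M[F]_(p1, q)) (V : 'M_(p2, q))
    (Y : 'M_(q, p1)) :
  U *m Y = 1%:M -> V *m Y = 0 -> \rank (col_mx U V) = (p1 + \rank V)%N.
Proof.
move=> UY VY; rewrite -addsmxE mxrank_disjoint_sum.
  by congr (_ + _)%N; apply/eqP/row_freeP; exists Y.
apply/eqP; rewrite -submx0; apply/rV_subP => v; rewrite sub_capmx => /andP[].
case/submxP => x vx /submxP[y vy].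
suff x0 : x = 0 by rewrite vx x0 mul0mx sub0mx.
by rewrite -[x]mulmx1 -UY mulmxA -vx vy -mulmxA VY mulmx0.
Qed.

(** * Reduction of the Hamiltonian pencil by constant operations *)

Section Pencil.
Variables (n m : nat) (A Q X : 'M[F]_n) (B S : 'M[F]_(n, m)) (W V : 'M[F]_m).
Variable s : F.
Hypotheses (Wsym : W^T = W) (Vsym : V^T = V) (Xsym : X^T = X).
Hypotheses (VWV : V *m W *m V = V) (WV : W *m V = V *m W).
Let SX := S + X *m B.
Let K := V *m SX^T.
Let G := 1%:M - V *m W.
Hypothesis SXker : SX *m (V *m W) = SX.
Hypothesis riccati : X *m A + A^T *m X - SX *m V *m SX^T + Q = 0.

(** [V] stands for the pseudo-inverse of [W], given by identities that survive a field embedding: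
    the lemma is applied to complexified matrices, whereas [mpinv] is real. [SXker] encodes the
    kernel condition of CGCARE. *)
Lemma pencil_rank :
  \rank (block_mx (block_mx A 0 (- Q) (- A^T) - s%:M) (col_mx B (- S))
                  (row_mx S^T B^T) W) =
  \rank (block_mx (block_mx (A - B *m K - s%:M) (- (B *m V *m B^T))
                            0 (- (A - B *m K)^T - s%:M))
                  (col_mx (B *m G) 0) (row_mx 0 (B *m G)^T) W).
Proof.
(* [U] encodes the costate [mu = lambda - X x] and the input
   [u + K x + V B^T mu]; [L] is the matching change of equations. *)
pose L : 'M[F]_((n + n) + m) :=
  block_mx (block_mx 1%:M 0 (- X) 1%:M) (col_mx (- (B *m V)) K^T) 0 1%:M.
pose U : 'M[F]_((n + n) + m) :=
  block_mx (block_mx 1%:M 0 X 1%:M) 0 (row_mx (- K) (- (V *m B^T))) 1%:M.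
have uL : L \in unitmx.
  by rewrite unitmxE det_ublock det_lblock !det1 !mulr1 unitr1.
have uU : U \in unitmx.
  by rewrite unitmxE det_lblock det_lblock !det1 !mulr1 unitr1.
have KW : K^T *m W = SX by rewrite /K trmx_mul trmxK Vsym -mulmxA SXker.
have VWS : W *m K = SX^T.
  by rewrite -[LHS]trmxK trmx_mul Wsym KW.
have GT : G^T = G by rewrite /G raddfB /= trmx1 trmx_mul Wsym Vsym WV.
have GV : G *m V = 0 by rewrite /G mulmxBl mul1mx VWV subrr.
have GK : G *m K = 0 by rewrite /K mulmxA GV mul0mx.
have SXT : SX^T = S^T + B^T *m X by rewrite /SX raddfD /= trmx_mul Xsym.
rewrite -(mxrank_conj_unit _ uL uU); congr (\rank _).
rewrite (scalar_mx_block n n) opp_block_mx add_block_mx !oppr0 !addr0.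
rewrite /L /U !mulmx_block !(mul_col_row, mul_row_col, mul_mx_row, mul_col_mx,
  mul_row_block, mul_block_col, mulmx_block, add_block_mx, add_row_mx,
  add_col_mx).
rewrite !(mul1mx, mul0mx, mulmx1, mulmx0, addr0, add0r).
have -> : B + - (B *m V) *m W = B *m G.
  by rewrite /G mulmxBr mulmx1 mulNmx mulmxA.
(* The kernel condition clears the costate rows of the input column. *)
have -> : - X *m B - S + K^T *m W = 0.
  by rewrite KW mulNmx -opprD [X *m B + S]addrC -/SX addNr.
have eA : - A^T - s%:M + K^T *m B^T = - (A - B *m K)^T - s%:M.
  by rewrite linearB /= (trmx_mul B) opprB addrC addrA.
rewrite !mul0mx !mulmxN -!mulmxA GK (mulmxA G) GV mul0mx !mulmx0 oppr0 col_mx0.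
rewrite -block_mxEv mul_row_block add_row_mx row_mx0 addr0 eA !mulmx1 !mulmx0.
rewrite VWS -SXT subrr add0r.
congr (block_mx (block_mx _ _ _ _) _ (row_mx _ _) _).
- by rewrite -addrA !mulNmx -opprD -mulmxDr -SXT -mulmxA -/K addrAC.
- by rewrite mulNmx mulmxA.
(* This is the block below A_X. Solving the Riccati equation for [Q] and expanding the quadratic
   term reduces its vanishing to additive cancellation. *)
- have hK : SX *m V *m SX^T = K^T *m S^T + K^T *m B^T *m X.
    rewrite /K trmx_mul trmxK Vsym -mulmxA -(mulmxA (SX *m V)) -mulmxDr.
    by rewrite -SXT mulmxA.
  have hQ : Q = SX *m V *m SX^T - (X *m A + A^T *m X).
    by move/eqP: riccati; rewrite addrC addr_eq0 opprB => /eqP.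
  rewrite -eA hQ hK mulNmx mulmxBr !mulmxDl !mulNmx scalar_mxC.
  move: (X *m A) (X *m s%:M) (A^T *m X) (_ *m S^T) (_ *m B^T *m X) => a b c d e.
  by apply/matrixP => i j; rewrite !mxE; ring.
- by rewrite trmx_mul GT /G mulmxBl mul1mx -WV mulmxA.
Qed.
End Pencil.

(** [P] fixes [W] on both sides and kills [b] and [c], so [P] and [1%:M - P] separate [W] from the
    rest. *)
Lemma mxrank_block_proj k m (M : 'M[F]_k) (b : 'M_(k, m)) (c : 'M_(m, k))
    (W P : 'M_m) :
    b *m P = 0 -> P *m c = 0 -> P *m W = W -> W *m P = W ->
  \rank (block_mx M b c W) = (\rank W + \rank (block_mx M b c 0))%N.
Proof.
move=> bP Pc PW WP.
have -> : block_mx M b c W = block_mx M b c 0 + block_mx 0 0 0 W.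
  by rewrite add_block_mx !addr0 add0r.
rewrite (@mxrank_add_split _ _ _ _ (block_mx 1%:M 0 0 (1%:M - P))
           (block_mx 0 0 0 P) (block_mx 1%:M 0 0 (1%:M - P))).
- by rewrite rank_diag_block_mx mxrank0 add0n addnC.
all: rewrite mulmx_block !(mul0mx, mulmx0, mul1mx, mulmx1, addr0, add0r).
- by rewrite mulmxBl mul1mx Pc subr0.
- by rewrite mulmxBl mul1mx PW subrr block_mx0.
- by rewrite Pc block_mx0.
- by rewrite PW.
- by rewrite mulmxBr mulmx1 bP subr0.
- by rewrite mulmxBr mulmx1 WP subrr block_mx0.
Qed.

(** The costate transforms contragrediently to the state, so one [h] puts both A_X and its negated
    transpose in block triangular form. *)
Lemma pencil_similar n m (a d e h : 'M[F]_n) (b : 'M_(n, m)) (c : 'M_(m, n)) :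
    h \in unitmx ->
  \rank (block_mx (block_mx a d 0 e) (col_mx b 0) (row_mx 0 c) (0 : 'M_m)) =
  \rank (block_mx (block_mx (invmx h *m a *m h) (invmx h *m d *m (invmx h)^T) 0
                            (h^T *m e *m (invmx h)^T))
                  (col_mx (invmx h *m b) 0) (row_mx 0 (c *m (invmx h)^T))
                  (0 : 'M_m)).
Proof.
move=> uh.
pose L : 'M[F]_((n + n) + m) :=
  block_mx (block_mx (invmx h) 0 0 h^T) 0 0 1%:M.
pose U : 'M[F]_((n + n) + m) :=
  block_mx (block_mx h 0 0 (invmx h)^T) 0 0 1%:M.
have uL : L \in unitmx.
  rewrite unitmxE !det_ublock det1 mulr1 unitrM -!unitmxE.
  by rewrite unitmx_inv unitmx_tr uh.
have uU : U \in unitmx.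
  rewrite unitmxE !det_ublock det1 mulr1 unitrM -!unitmxE.
  by rewrite unitmx_tr unitmx_inv uh.
rewrite -(mxrank_conj_unit _ uL uU); congr (\rank _).
rewrite /L /U !mulmx_block !(mul0mx, mulmx0, mul1mx, mulmx1, addr0, add0r).
rewrite !mulmx_block mul_block_col mul_row_block.
by rewrite !(mul0mx, mulmx0, mul1mx, mulmx1, addr0, add0r).
Qed.

(** A right inverse of [row_mx a11 b] is supported on columns where all other rows vanish, so the
    first block row splits off. Dually, a left inverse of [e11] stacked on [c] then splits off a
    block column. *)
Lemma pencil_peel r q m (a11 e11 d11 : 'M[F]_r) (a12 d12 : 'M_(r, q))
    (d21 e21 : 'M_(q, r)) (g1 g2 d22 : 'M_q) (b : 'M_(r, m)) (c : 'M_(m, r)) :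
    row_free (row_mx a11 b) -> row_free (row_mx e11^T c^T) ->
  \rank (block_mx (block_mx (block_mx a11 a12 0 g1) (block_mx d11 d12 d21 d22)
                            0 (block_mx e11 0 e21 g2))
                  (col_mx (col_mx b 0) 0) (row_mx 0 (row_mx c 0))
                  (0 : 'M_m)) =
  (r + (r + \rank (block_mx g1 d22 0 g2)))%N.
Proof.
case/row_freeP => YZ; rewrite -[YZ]vsubmxK mul_row_col.
move: (usubmx YZ) (dsubmx YZ) => Y Z YZ1.
case/row_freeP => YZ'; rewrite -[YZ']vsubmxK mul_row_col.
move: (usubmx YZ') (dsubmx YZ') => Y' Z' YZ1'.
pose R1 := row_mx (row_mx (row_mx a11 a12) (row_mx d11 d12)) b.
pose R2 : 'M_(_, r + q + (r + q) + m) :=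
   row_mx (row_mx (row_mx 0 g1) (row_mx d21 d22)) (0 : 'M_(q, m)).
pose R3 : 'M_(_, r + q + (r + q) + m) :=
   row_mx (row_mx 0 (block_mx e11 0 e21 g2)) 0.
pose R5 : 'M_(_, r + q + (r + q) + m) :=
   row_mx (row_mx 0 (row_mx c 0)) (0 : 'M_m).
set T := block_mx _ _ _ _.
have {T} -> : T = col_mx (col_mx (col_mx R1 R2) R3) R5.
  rewrite /T !block_mxEv -!block_mxEh !block_mxEv -block_mxEh.
  by rewrite /R1 /R2 /R3 /R5 !block_mxEv.
have -> : \rank (col_mx (col_mx (col_mx R1 R2) R3) R5)
          = \rank (col_mx R1 (col_mx (col_mx R2 R3) R5)).
  by apply/eqP; rewrite eqn_leq !mxrankS // !col_mx_sub -?andbA;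
    apply/and4P; split; eauto using submx_col_mxl, submx_col_mxr, submx_refl.
rewrite (@mxrank_col_mx_split _ _ _ _ _
           (col_mx (col_mx (col_mx Y 0) 0) Z)); last 2 first.
- by rewrite /R1 !mul_row_col !mulmx0 !addr0.
- rewrite !mul_col_mx /R2 /R3 /R5 !mul_row_col !(mulmx0, mul0mx) !addr0.
  by rewrite !col_mx0.
congr (_ + _)%N; rewrite -mxrank_tr.
pose C2 : 'M[F]_(q + (r + q) + m, q) := col_mx (col_mx g1 0) 0.
pose C3 : 'M[F]_(q + (r + q) + m, r) := col_mx (col_mx d21 (col_mx e11 e21)) c.
pose C4 : 'M[F]_(q + (r + q) + m, q) := col_mx (col_mx d22 (col_mx 0 g2)) 0.
(* Once [R1] is gone, the first state column and the input column are zero; the other three are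
   named so that transposition allows a second row split. *)
have -> : col_mx (col_mx R2 R3) R5 =
    row_mx (row_mx (row_mx 0 C2) (row_mx C3 C4)) 0.
  rewrite /C2 /C3 /C4 /R2 /R3 /R5 !block_mxEv.
  apply/matrixP => i j.
  case: (split_ordP j) => j1 ->; first (case: (split_ordP j1) => j2 ->;
    case: (split_ordP j2) => j3 ->); case: (split_ordP i) => i1 ->;
    try (case: (split_ordP i1) => i2 ->; try (case: (split_ordP i2) => i3 ->));
    by rewrite !(col_mxEu, col_mxEd, row_mxEl, row_mxEr, mxE).
rewrite !tr_row_mx !trmx0.
have -> : \rank (col_mx (col_mx (col_mx (0 : 'M_(r, _)) C2^T)
                                (col_mx C3^T C4^T)) (0 : 'M_(m, _)))
          = \rank (col_mx C3^T (col_mx C2^T C4^T)).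
  by apply/eqP; rewrite eqn_leq !mxrankS // !col_mx_sub ?sub0mx ?andbT -?andbA /=;
    apply/and3P; split; eauto using submx_col_mxl, submx_col_mxr, submx_refl.
rewrite (@mxrank_col_mx_split _ _ _ _ _
           (col_mx (col_mx 0 (col_mx Y' 0)) Z')); last 2 first.
- by rewrite /C3 !tr_col_mx !mul_row_col !mulmx0 !addr0 add0r.
- rewrite !mul_col_mx /C2 /C4 !tr_col_mx !mul_row_col !trmx0.
  by rewrite !(mulmx0, mul0mx) !addr0 !col_mx0.
congr (_ + _)%N; rewrite -tr_row_mx mxrank_tr.
have -> : row_mx C2 C4 =
    col_mx (col_mx (row_mx g1 d22) (col_mx 0 (row_mx 0 g2))) (0 : 'M_(m, q + q)).
  rewrite /C2 /C4 -block_mxEh block_mxEv row_mx0.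
  rewrite -[X in row_mx (col_mx _ X) _]col_mx0 -!block_mxEh !block_mxEv.
  by rewrite -block_mxEh block_mxEv row_mx0.
apply/eqP; rewrite block_mxEv eqn_leq !mxrankS // !col_mx_sub ?sub0mx ?andbT /=;
  apply/andP; split; eauto using submx_col_mxl, submx_col_mxr, submx_refl.
Qed.

End RankReduction.

(** * Eigenvalues and singular shifts *)

Lemma similar_sub_scalar (F : fieldType) n (H M N : 'M[F]_n) (s : F) :
  H \in unitmx -> invmx H *m M *m H = N ->
  invmx H *m (M - s%:M) *m H = N - s%:M.
Proof.
move=> uH <-; rewrite mulmxBr mulmxBl mul_mx_scalar -scalemxAl mulVmx //.
by rewrite scalemx1.
Qed.

Lemma eigenvalue_unitmx (F : fieldType) n (M : 'M[F]_n) (s : F) :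
  eigenvalue M s = (M - s%:M \notin unitmx).
Proof. by rewrite /eigenvalue /eigenspace kermx_eq0 row_free_unit. Qed.

(** This supplies a point at which the normal rank is attained. *)
Lemma exists_not_eigenvalue (F : closedFieldType) n1 n2
    (M1 : 'M[F]_n1) (M2 : 'M[F]_n2) :
  exists s, ~~ (eigenvalue M1 s || eigenvalue M2 s).
Proof.
have /closed_nonrootP[s] : char_poly M1 * char_poly M2 != 0.
  by rewrite mulf_neq0 ?monic_neq0 ?char_poly_monic.
by rewrite rootM -!eigenvalue_root_char; exists s.
Qed.

(** * The Hautus test and the rank of the Rosenbrock matrix *)

Section Zeros.
Variable R : realType.

(** If v A = s v and v B = 0, then v A^k B = s^k v B = 0 for all k, so v kills the reachability
    matrix, whose real right inverse remains one over the complex numbers. *)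
Lemma reachable_row_free n m (A : 'M[R]_n) (B : 'M[R]_(n, m)) (s : R[i]) :
  reachable A B -> row_free (row_mx (cmx A - s%:M) (cmx B)).
Proof.
move=> reachAB; have /row_freeP[Y rY] : row_free (reachability_mx A B).
  by rewrite /row_free reachAB.
rewrite -kermx_eq0 -submx0; apply/rV_subP => v /sub_kermxP.
rewrite mul_mx_row => /eqP; rewrite row_mx_eq0 => /andP[/eqP vA /eqP vB].
have vAs : v *m cmx A = s *: v.
  by apply/eqP; rewrite -subr_eq0 -mul_mx_scalar -mulmxBr vA.
have vAk k : v *m cmx (A ^+ k) = s ^+ k *: v.
  elim: k => [|k IHk]; first by rewrite !expr0 /cmx map_mx1 mulmx1 scale1r.
  by rewrite exprSr /cmx map_mxM mulmxA IHk -scalemxAl vAs scalerA -exprSr.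
suff v0 : v *m cmx (reachability_mx A B) = 0.
  rewrite submx0 -[v]mulmx1 -(map_mx1 (real_complex R)) -rY map_mxM mulmxA.
  by rewrite v0 mul0mx.
(* A column index of the [\mxrow] encodes a power of [A] and a column of [B]. *)
apply/rowP => j; rewrite [RHS]mxE.
have : (v *m cmx (A ^+ (tagnat.sig1 j) *m B)) 0 (tagnat.sig2 j) = 0.
  by rewrite /cmx map_mxM mulmxA vAk -scalemxAl vB scaler0 mxE.
by rewrite mxE => <-; rewrite mxE; apply: eq_bigr => k _; rewrite !mxE.
Qed.

(** [D] can stay existential: it lies off the diagonal of a block triangular matrix, so it does not
    affect invertibility. *)
Lemma rosenbrock_rank m r q (A Q X H : 'M[R]_(r + q)) (B S : 'M[R]_(r + q, m))
    (W : 'M[R]_m) (A11 : 'M[R]_r) (A12 : 'M[R]_(r, q)) (Gamma : 'M[R]_q)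
    (B21 : 'M[R]_(r, m)) :
    W = W^T -> X = X^T -> CGCARE A B Q S W X -> H \in unitmx ->
    invmx H *m A_of A B S W X *m H = block_mx A11 A12 0 Gamma ->
    invmx H *m (B *m kerproj W) = col_mx B21 0 ->
    reachable A11 B21 ->
  exists D : 'M[R[i]]_q, forall s,
    \rank (rosenbrock (ham_A A Q) (ham_B B S) (ham_C B S) W s) =
    (\rank W + (r + (r + \rank (block_mx (cmx Gamma - s%:M) D
                                        0 ((cmx (- Gamma))^T - s%:M)))))%N.
Proof.
move=> Wsym Xsym [riccati kerW] uH hA hB hreach.
have [WVW VWV tWV tVW] := mpinvP W.
set V := mpinv W in WVW VWV tWV tVW *.
(* As [W] is symmetric, transposing the Penrose equations shows that [V^T] is also a pseudo-inverse
   of [W]. *)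
have Vsym : V^T = V.
  apply: (@penrose_unique _ _ _ W); last exact: mpinvP.
  split.
  - by move/(congr1 trmx): WVW; rewrite !trmx_mul -Wsym mulmxA.
  - by move/(congr1 trmx): VWV; rewrite !trmx_mul -Wsym mulmxA.
  - by rewrite trmx_mul trmxK -Wsym -tVW trmx_mul -Wsym.
  - by rewrite trmx_mul trmxK -Wsym -tWV trmx_mul -Wsym.
have WV : W *m V = V *m W by rewrite -tVW trmx_mul Vsym -Wsym.
have SXG : (S + X *m B) *m kerproj W = 0.
  apply/matrixP => i j; rewrite [RHS]mxE.
  have WG : W *m kerproj W = 0 by rewrite mulmxBr mulmx1 mulmxA WVW subrr.
  have := kerW (col j (kerproj W)).
  rewrite colE !mulmxA WG mul0mx -colE => /(_ erefl).
  by move/colP/(_ i); rewrite !mxE.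
have SXVW : (S + X *m B) *m (V *m W) = S + X *m B.
  by apply/esym/eqP; rewrite -subr_eq0 -{1}[S + _]mulmx1 -mulmxBr SXG.
pose K := V *m (S + X *m B)^T.
have eK : A_of A B S W X = A - B *m K by [].
have eG : kerproj W = 1%:M - V *m W by [].
pose f := real_complex R.
have SXT : S^T + B^T *m X = (S + X *m B)^T.
  by rewrite linearD /= trmx_mul -Xsym.
rewrite /GCARE -/V SXT in riccati.
clearbody V.
(* The witness is the lower right block of - B W^+ B^T in the reachability basis. *)
exists (drsubmx (invmx (cmx H) *m - (cmx B *m cmx V *m (cmx B)^T)
                   *m (invmx (cmx H))^T)) => s.
rewrite /rosenbrock /ham_A /ham_B /ham_C /cmx map_block_mx map_col_mx map_row_mx.
rewrite !raddf0 !map_mxN -!map_trmx.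
rewrite (@pencil_rank _ _ _ _ _ (map_mx f X) _ _ _ (map_mx f V)); first 1 last.
- by rewrite map_trmx -Wsym.
- by rewrite map_trmx Vsym.
- by rewrite map_trmx -Xsym.
- by rewrite -!map_mxM VWV.
- by rewrite -!map_mxM WV.
- by rewrite -!(map_mxM, map_mxD) SXVW.
- move/(congr1 (map_mx f)): riccati.
  by rewrite !(map_mxD, map_mxN, map_mxM) -!map_trmx !(map_mxD, map_mxM) map_mx0.
have -> : map_mx f A - map_mx f B *m
    (map_mx f V *m (map_mx f S + map_mx f X *m map_mx f B)^T)
          = map_mx f (A_of A B S W X).
  by rewrite eK /K map_mxB 2!map_mxM -map_trmx map_mxD map_mxM.
have -> : map_mx f B *m (1%:M - map_mx f V *m map_mx f W)
          = map_mx f (B *m kerproj W).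
  by rewrite eG map_mxM map_mxB map_mx1 map_mxM.
(* [V *m W] is the projector complementary to [kerproj W]; hence it kills the blocks built from B
   G. *)
rewrite (@mxrank_block_proj _ _ _ _ _ _ _ (map_mx f (V *m W))); first 1 last.
- rewrite mul_col_mx mul0mx -map_mxM -mulmxA eG mulmxBl mul1mx.
  by rewrite (mulmxA (V *m W)) VWV subrr mulmx0 map_mx0 col_mx0.
- rewrite mul_mx_row mulmx0 map_trmx -map_mxM eG trmx_mul linearB /= trmx1 trmx_mul.
  rewrite Vsym -Wsym WV mulmxA mulmxBr mulmx1 mulmxA VWV subrr.
  by rewrite mul0mx map_mx0 row_mx0.
- by rewrite -map_mxM -WV WVW.
- by rewrite -map_mxM mulmxA WVW.
rewrite mxrank_map; congr (_ + _)%N.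
rewrite (@pencil_similar _ _ _ _ _ _ (map_mx f H)) ?map_unitmx //.
have uHf : map_mx f H \in unitmx by rewrite map_unitmx.
have hAf : invmx (map_mx f H) *m map_mx f (A_of A B S W X) *m map_mx f H =
    block_mx (map_mx f A11) (map_mx f A12) 0 (map_mx f Gamma).
  by rewrite -map_invmx -!map_mxM hA map_block_mx map_mx0.
have eN : (map_mx f H)^T *m (- (map_mx f (A_of A B S W X))^T - s%:M)
      *m (invmx (map_mx f H))^T =
    block_mx (- (map_mx f A11)^T - s%:M) 0 (- (map_mx f A12)^T)
             ((map_mx f (- Gamma))^T - s%:M).
  have -> : - (map_mx f (A_of A B S W X))^T - s%:M =
      (- map_mx f (A_of A B S W X) - s%:M)^T.
    by rewrite linearB linearN /= tr_scalar_mx.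
  rewrite -mulmxA -!trmx_mul (similar_sub_scalar _ uHf (erefl _)).
  rewrite mulmxN mulNmx hAf.
  rewrite scalar_mx_block !opp_block_mx add_block_mx tr_block_mx !oppr0 !addr0.
  by rewrite !linearB !linearN /= !tr_scalar_mx !trmx0 map_mxN linearN.
rewrite (similar_sub_scalar _ uHf hAf) eN -trmx_mul.
rewrite scalar_mx_block opp_block_mx add_block_mx !oppr0 !addr0.
have -> : invmx (map_mx f H) *m map_mx f (B *m kerproj W)
          = col_mx (map_mx f B21) 0.
  by rewrite -map_invmx -map_mxM hB map_col_mx map_mx0.
rewrite tr_col_mx trmx0.
set d := invmx _ *m _ *m _; rewrite -[d in LHS]submxK pencil_peel ?map_mxN //.
  exact: reachable_row_free.
(* The transposed adjoint block is - A11 - s, the negative of A11 - (- s): the Hautus test is used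
   at [- s], and the state part of the right inverse changes sign. *)
have /row_freeP[YZ] := reachable_row_free (- s) hreach.
rewrite -[YZ]vsubmxK mul_row_col => YZ1.
apply/row_freeP; exists (col_mx (- usubmx YZ) (dsubmx YZ)).
rewrite mul_row_col trmxK -YZ1 mulmxN -mulNmx; congr (_ *m _ + _).
by rewrite linearB linearN /= trmxK tr_scalar_mx opprB opprK raddfN addrC opprK.
Qed.

End Zeros.

(** * Normal rank and invariant zeros *)

Theorem theorem5 (R : realType) (n m : nat)
    (A Q : 'M[R]_n) (B S : 'M[R]_(n, m)) (W : 'M[R]_m)
    (hPi : possemidef (Popov Q S W))
    (X : 'M[R]_n) (hXsym : X = X^T) (hX : CGCARE A B Q S W X)
    (r q : nat) (hrq : (r + q)%N = n)
    (H : 'M[R]_n) (hH : H \in unitmx)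
    (A11 : 'M[R]_r) (A12 : 'M[R]_(r, q)) (Gamma : 'M[R]_q)
    (B21 : 'M[R]_(r, m))
    (hA : invmx H *m A_of A B S W X *m H
          = castmx (hrq, hrq) (block_mx A11 A12 0 Gamma))
    (hB : invmx H *m (B *m kerproj W)
          = castmx (hrq, erefl m) (col_mx B21 0))
    (hreach : reachable A11 B21) :
  invariant_zeros (ham_A A Q) (ham_B B S) (ham_C B S) W
  = spectrum Gamma `|` spectrum (- Gamma).
Proof.
have Wsym : W = W^T by case: hPi => /(congr1 drsubmx); rewrite tr_block_mx !block_mxKdr.
subst n; rewrite castmx_id in hA; rewrite castmx_id in hB.
have [D hD] := rosenbrock_rank Wsym hXsym hX hH hA hB hreach.
pose N s := block_mx (cmx Gamma - s%:M) D 0 ((cmx (- Gamma))^T - s%:M).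
pose Z := ham_A A Q.
(* The determinant of [N s] is the product of those of its diagonal blocks; transposing the second
   reduces it to a shift of - Gamma. *)
have unitN s : (N s \in unitmx) =
    ~~ (eigenvalue (cmx Gamma) s || eigenvalue (cmx (- Gamma)) s).
  rewrite !eigenvalue_unitmx -negb_and negbK -[X in _ && X]unitmx_tr.
  by rewrite linearB /= tr_scalar_mx !unitmxE det_ublock unitrM.
(* The size of [N s] bounds the rank from above, and a common non-eigenvalue reaches the bound. *)
have nr : normal_rank Z (ham_B B S) (ham_C B S) W
          = (\rank W + (r + (r + (q + q))))%N.
  apply/eqP; rewrite eqn_leq; apply/andP; split.
    have [s <-] := normal_rank_attained Z (ham_B B S) (ham_C B S) W.
    by rewrite hD !leq_add2l rank_leq_row.
  have [s notG] := exists_not_eigenvalue (cmx Gamma) (cmx (- Gamma)).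
  have uNs : N s \in unitmx by rewrite unitN.
  have := rank_le_normal_rank Z (ham_B B S) (ham_C B S) W s.
  by rewrite hD (mxrank_unit uNs).
apply/predeqP => s.
rewrite /invariant_zeros /spectrum /= nr hD -/(N s) !ltn_add2l.
have -> : (\rank (N s) < q + q)%N = (N s \notin unitmx).
  by rewrite -row_free_unit ltn_neqAle rank_leq_row andbT.
by rewrite unitN negbK; split=> [/orP|h]; last exact/orP.
Qed.
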